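(* Let $k,\eta,l>1$ be integers, and let $G=W''(\eta,k,l)$ be a generalized windmill graph of Type II. Then for every integer $q\ge 0$, $$Z_q(G)=\begin{cases}\min\{\eta (k-1)+l,\ \eta k\} & \text{if } q=0,\\ \eta (k-1)+l & \text{if } q\ge 1.\end{cases}$$
   Context: Graphs are finite, simple and undirected. The generalized windmill graph of Type II, $W''(\eta,k,l)$, consists of $\eta$ disjoint copies of the complete graph $K_k$ (with no edges between different copies) together with $l$ central vertices, where every central vertex is adjacent to every vertex of every copy of $K_k$, and no two central vertices are adjacent. The $q$-analogue of zero forcing ($Z_q$ game), for a fixed integer $q\ge 0$, is a game between a player and an oracle on a graph $G$. Initially all vertices are unfilled. The player repeatedly uses the following rules. Rule 1: fill any vertex at the cost of one token. Rule 2 (forcing rule): at no cost, a filled vertex with a unique unfilled neighbor forces that neighbor to be filled. Rule 3: let $F$ be the set of filled vertices and let $U_1,\dots,U_r$ be the connected components of $G[V\setminus F]$; if $r>q$, the player selects at least $q+1$ of the components $U_i$; the oracle then chooses a nonempty subset $\{U_{i_1},\dots,U_{i_s}\}$ of the selected components; the player may then, at no cost, apply the forcing rule in the subgraph of $G$ induced by $F\cup U_{i_1}\cup\dots\cup U_{i_s}$. The number $Z_q(G)$ is the minimum number of tokens with which the player can guarantee to fill all vertices of $G$, against an oracle trying to maximize the number of tokens spent. *)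

(* Defs.v *)
From mathcomp Require Import all_boot.
From mathcomp Require Import boolp.

Set Implicit Arguments.
Unset Strict Implicit.
Unset Printing Implicit Defensive.

Record sgraph := SGraph {
  svertex :> finType;
  sedge : rel svertex;
  sedge_sym : symmetric sedge;
  sedge_irrefl : irreflexive sedge
}.

Section Game.
Variable G : sgraph.
Implicit Types (F W : {set G}) (S R : {set {set G}}).

Definition induced_edge W : rel G :=
  [rel x y | [&& x \in W, y \in W & sedge x y]].

Definition components W : {set {set G}} :=
  equivalence_partition (connect (induced_edge W)) W.

(* In G[W], with F the filled vertices, v is filled and w is its unique
   unfilled neighbour. *)
Definition forces W F : rel G :=
  [rel v w | (v \in F) && ([set u in W :\: F | sedge v u] == [set w])].

Definition force_step W : rel {set G} :=
  [rel F F' | [exists v, exists w, forces W F v w && (F' == w |: F)]].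

(* [wins q F t]: from the filled set F, the player has a strategy for the
   Z_q game that fills every vertex with at most t further tokens, whatever
   the oracle does.  Being inductive, it only accepts strategies all of whose
   plays are finite.  In [wins_oracle], S is the player's selection, R the
   oracle's answer, and [reply R] the filled set that the player reaches by
   any number (possibly zero) of forces in the subgraph induced by F and the
   components in R. *)
Inductive wins (q : nat) : {set G} -> nat -> Prop :=
| wins_done t : wins q [set: G] t
| wins_token F t v : wins q (v |: F) t -> wins q F t.+1
| wins_force F t v w :
    forces [set: G] F v w -> wins q (w |: F) t -> wins q F t
| wins_oracle F t S (reply : {set {set G}} -> {set G}) :
    S \subset components (~: F) -> q < #|S| ->
    (forall R, R \subset S -> R != set0 ->
       connect (force_step (F :|: cover R)) F (reply R)) ->
    (forall R, R \subset S -> R != set0 -> wins q (reply R) t) ->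
    wins q F t.

Lemma wins_exists q : exists t, `[< wins q set0 t >].
Proof.
suff fill n : forall F, #|~: F| = n -> wins q F n.
  by exists #|~: (set0 : {set G})|; apply/asboolP/fill.
elim: n => [|n IHn] F cF.
  rewrite (_ : F = [set: G]); first exact: wins_done.
  by rewrite -[F]setCK (cards0_eq cF) setC0.
have /card_gt0P[v vF] : 0 < #|~: F| by rewrite cF.
apply: (@wins_token _ _ _ v); apply: IHn.
by move: cF; rewrite (cardsD1 v) vF setCU setIC -setDE => -[].
Qed.

Definition Zq (q : nat) : nat := ex_minn (wins_exists q).

End Game.

Section Windmill.
Variables eta k l : nat.

(* [inl (i, a)] is the a-th vertex of the i-th copy of K_k, and [inr c] is a
   central vertex. *)
Definition windmill2_vertex : finType := ('I_eta * 'I_k + 'I_l)%type.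

Definition windmill2_edge : rel windmill2_vertex := fun x y =>
  match x, y with
  | inl (i, a), inl (j, b) => (i == j) && (a != b)
  | inr _, inr _ => false
  | _, _ => true
  end.

Lemma windmill2_sym : symmetric windmill2_edge.
Proof.
by move=> [[i a]|c] [[j b]|d] //=; rewrite eq_sym [b == a]eq_sym.
Qed.

Lemma windmill2_irrefl : irreflexive windmill2_edge.
Proof. by move=> [[i a]|c] //=; rewrite !eqxx. Qed.

Definition windmill2 : sgraph := SGraph windmill2_sym windmill2_irrefl.

End Windmill.

(* Main.v *)
Require Import Defs.
From mathcomp Require Import all_boot.
From mathcomp Require Import boolp zify.

Set Implicit Arguments.
Unset Strict Implicit.
Unset Printing Implicit Defensive.

(** Both upper bounds are explicit strategies.  Paying for all centres and for
    all but one vertex of each clique lets every clique complete itself by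
    ordinary forces ([wins_centre_strategy]).  Paying for all cliques leaves the
    centres as isolated unfilled vertices, and for q = 0 each of them may be
    selected alone and forced ([wins_clique_strategy]).

    The lower bound comes from a potential that estimates the number of further
    tokens needed from a filled set F.  Let u_i be the number of
    unfilled vertices in clique i and c the number of unfilled centres.
    Pursuing the first strategy from F costs the sum of the (u_i - 1)^+ plus c,
    minus one if c > 0 and some clique is full, since a vertex of that clique
    then forces the last centre.  Pursuing the second one costs the sum of the
    u_i, minus one if this sum is positive and a centre is filled, since that
    centre then forces the last clique vertex.  The potential is the first cost
    for q >= 1 and the minimum of both for q = 0.  It is 0 on the full vertex
    set and takes the announced value on the empty set, so it suffices that it
    drops by at most one per token ([potential_token]) and never during forces.

    For forces in the whole graph this is a case analysis on the kind of the
    forced vertex ([potential_force]).  Against an application of the third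
    rule the oracle answers with the whole selection S ([potential_oracle]).
    When some clique vertex is unfilled, this reveals every unfilled vertex
    that matters, so the same analysis applies: if some centre is also unfilled
    the unfilled graph is connected and everything is revealed, and otherwise
    the components are the unfilled parts of cliques.  When only centres are
    unfilled, the potential is 0 for q = 0, while for q >= 1 at least two
    centres are revealed and block all forces ([no_force_full_cliques]). *)

(** * The game on an arbitrary graph *)

Section GeneralGames.
Variable G : sgraph.
Implicit Types (F W X : {set G}) (S : {set {set G}}) (Phi : {set G} -> nat).

Lemma Zq_eq q n :
  wins q (set0 : {set G}) n ->
  (forall t, wins q (set0 : {set G}) t -> n <= t) -> Zq G q = n.
Proof.
move=> win_n min_n; rewrite /Zq; case: ex_minnP => m /asboolP win_m min_m.
by apply/eqP; rewrite eqn_leq min_n // min_m //; apply/asboolP.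
Qed.

Lemma wins_tokens q X F t : wins q (X :|: F) t -> wins q F (#|X| + t).
Proof.
move En: #|X| => n; elim: n X En F => [|n IHn] X cX F winXF.
  by rewrite add0n -[F]set0U -(cards0_eq cX).
have /card_gt0P[x xX] : 0 < #|X| by rewrite cX.
rewrite addSn; apply: (@wins_token _ _ _ _ x); apply: (IHn (X :\ x)).
  by move: cX; rewrite (cardsD1 x) xX => -[].
by rewrite setUA [_ :|: [set x]]setUC setD1K.
Qed.

(** Filling is free from F on if, at every filled set above F, some further
    vertex can be obtained without a token, by whichever rule. *)
Lemma wins_free q F :
  (forall F', F \subset F' -> F' != [set: G] ->
     exists2 w, w \notin F' & wins q (w |: F') 0 -> wins q F' 0) ->
  wins q F 0.
Proof.
move=> step; move En: #|~: F| => n.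
(* The induction is over all sets above F, to which [step] applies. *)
have: F \subset F by [].
elim: n {-2}F En => [|n IHn] F' cF' sFF'.
  by rewrite -[F']setCK (cards0_eq cF') setC0; apply: wins_done.
have nT : F' != [set: G].
  by apply: contra_eq_neq cF' => ->; rewrite setCT cards0.
have [w wF'] := step F' sFF' nT; apply; apply: IHn.
  by move: cF'; rewrite (cardsD1 w) inE wF' setCU setIC -setDE => -[].
exact: subset_trans sFF' (subsetUr _ _).
Qed.

(** Lower bounds by a potential.  The oracle answers every selection [S] with
    [S] itself, so only that reply has to be controlled. *)
Lemma wins_lower_bound q Phi :
  Phi [set: G] = 0 ->
  (forall F v, Phi F <= (Phi (v |: F)).+1) ->
  (forall F v w, forces [set: G] F v w -> Phi F <= Phi (w |: F)) ->
  (forall F S F', S \subset components (~: F) -> q < #|S| ->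
     connect (force_step (F :|: cover S)) F F' -> Phi F <= Phi F') ->
  forall F t, wins q F t -> Phi F <= t.
Proof.
move=> PhiT Ptok Pfor Pora F t.
elim=> {F t} [t|F t v _ IH|F t v w Fvw _ IH|F t S reply sS qS ok _ IH].
- by rewrite PhiT.
- exact: leq_trans (Ptok F v) _.
- exact: leq_trans (Pfor F v w Fvw) IH.
have S0 : S != set0 by rewrite -card_gt0 (leq_ltn_trans _ qS).
by apply: leq_trans (IH S (subxx _) S0); apply: Pora (ok S (subxx _) S0).
Qed.

Lemma component_neq0 W B : B \in components W -> B != set0.
Proof.
case/imsetP=> x xW ->; apply/set0Pn; exists x.
by rewrite inE xW connect0.
Qed.

Lemma cover_components_sub W S : S \subset components W -> cover S \subset W.
Proof.
move=> sS; apply/bigcupsP=> B /(subsetP sS)/imsetP[x _ ->].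
by apply/subsetP=> y; rewrite inE => /andP[].
Qed.

Lemma cover_components_closed W S x y :
  S \subset components W -> x \in cover S -> y \in W -> sedge x y ->
  y \in cover S.
Proof.
move=> sS xS yW xy; have xW := subsetP (cover_components_sub sS) x xS.
case/bigcupP: xS => B BS xB; apply/bigcupP; exists B => //.
case/imsetP: (subsetP sS B BS) xB => z _ ->.
rewrite !inE yW => /andP[_ zx]; apply: connect_trans zx (connect1 _).
by rewrite /induced_edge /= xW yW.
Qed.

Lemma forcesP W F v w :
  reflect [/\ v \in F, w \in W, w \notin F, sedge v w
            & forall u, u \in W -> u \notin F -> sedge v u -> u = w]
          (forces W F v w).
Proof.
apply: (iffP andP) => [[vF /eqP E]|[vF wW wF vw U]].
  have: w \in [set u in W :\: F | sedge v u] by rewrite E set11.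
  rewrite !inE => /andP[/andP[wF wW] vw]; split=> // u uW uF vu.
  by apply/set1P; rewrite -E !inE uW uF.
split=> //; apply/eqP/setP=> u; rewrite !inE.
apply/andP/eqP => [[/andP[uF uW] vu]|->]; first exact: U.
by rewrite wF wW.
Qed.

Lemma isolated_component W w :
  w \in W -> (forall x, x \in W -> ~~ sedge w x) -> [set w] \in components W.
Proof.
move=> wW iso; apply/imsetP; exists w => //; apply/setP=> y; rewrite !inE.
apply/eqP/andP => [->|[_ /connectP[[|x p] //= /andP[+ _] _]]].
  by rewrite wW connect0.
by rewrite /induced_edge /= => /and3P[_ xW]; rewrite (negbTE (iso x xW)).
Qed.

(** For q = 0 a single component may be selected, which leaves the oracle no
    choice: v then sees only w, whatever else is unfilled. *)
Lemma wins_isolated F v w t :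
  v \in F -> w \notin F -> sedge v w ->
  (forall x, x \notin F -> ~~ sedge w x) ->
  wins 0 (w |: F) t -> wins 0 F t.
Proof.
move=> vF wF vw iso win.
have compw : [set w] \in components (~: F).
  by apply: isolated_component => [|x]; rewrite inE //; apply: iso.
apply: (@wins_oracle _ 0 F t [set [set w]] (fun=> w |: F)) => //.
- by rewrite sub1set.
- by rewrite cards1.
move=> R; rewrite subset1 => /orP[/eqP-> _|->//].
apply/connect1/existsP; exists v; apply/existsP; exists w.
rewrite eqxx andbT /cover big_set1; apply/forcesP.
split=> // [|u]; first by rewrite !inE eqxx orbT.
by rewrite !inE => /orP[->//|/eqP].
Qed.

End GeneralGames.

(** * The potential on a windmill graph *)

Section Windmill.
Variables k eta l : nat.
Hypotheses (hk : 1 < k) (heta : 1 < eta) (hl : 1 < l).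
Local Notation G := (windmill2 eta k l).
Implicit Types (F W : {set G}) (S : {set {set G}}) (v w : G).
Implicit Types (i j : 'I_eta) (a b : 'I_k) (c d : 'I_l).

Definition cliquev i a : G := inl (i, a).
Definition centre c : G := inr c.

Definition gap F i := #|[set a | cliquev i a \notin F]|.
Definition centre_gap F := #|[set c | centre c \notin F]|.
Definition clique_gap F := \sum_i gap F i.
Definition clique_excess F := \sum_i (gap F i).-1.
Definition has_full_clique F := [exists i, gap F i == 0].

(** The cost of filling the centres, the last one of which is free once some
    clique is full, and all but one vertex of each clique. *)
Definition centre_cost F :=
  clique_excess F + centre_gap F - ((0 < centre_gap F) && has_full_clique F).

(** The cost of filling the cliques, the last vertex of which is free if some
    centre is already filled; single centres are then forced for free in the
    game with q = 0. *)
Definition clique_cost F :=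
  clique_gap F - ((centre_gap F < l) && (0 < clique_gap F)).

Definition potential q F :=
  if q == 0 then minn (centre_cost F) (clique_cost F) else centre_cost F.

Lemma gap_cliqueU F i b j : cliquev i b \notin F ->
  gap F j = gap (cliquev i b |: F) j + (j == i).
Proof.
move=> bF; case: (eqVneq j i) => [->|ji]; last first.
  rewrite addn0; apply: eq_card => a; rewrite !inE.
  by case: eqP => // -[/eqP]; rewrite (negbTE ji).
rewrite addnC /gap (cardsD1 b) inE bF; congr (_ + _).
apply: eq_card => a; rewrite !inE negb_or; congr (~~ _ && _).
by apply/eqP/eqP => [->|[]].
Qed.

Lemma gap_centreU F c i : gap (centre c |: F) i = gap F i.
Proof. by apply: eq_card => a; rewrite !inE. Qed.

Lemma centre_gap_cliqueU F i b :
  centre_gap (cliquev i b |: F) = centre_gap F.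
Proof. by apply: eq_card => c; rewrite !inE. Qed.

Lemma centre_gap_centreU F c : centre c \notin F ->
  centre_gap F = (centre_gap (centre c |: F)).+1.
Proof.
move=> cF; rewrite /centre_gap (cardsD1 c) inE cF; congr (_.+1).
by apply: eq_card => d; rewrite !inE negb_or.
Qed.

Lemma clique_gap_cliqueU F i b : cliquev i b \notin F ->
  clique_gap F = (clique_gap (cliquev i b |: F)).+1.
Proof.
move=> bF; rewrite /clique_gap (eq_bigr _ (fun j _ => gap_cliqueU j bF)).
by rewrite big_split /= -big_mkcond big_pred1_eq addn1.
Qed.

Lemma clique_excess_cliqueU F i b : cliquev i b \notin F ->
  clique_excess F = clique_excess (cliquev i b |: F) + (1 < gap F i).
Proof.
move=> bF; rewrite /clique_excess (bigD1 i) //= [in RHS](bigD1 i) //=.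
have -> : \sum_(j | j != i) (gap F j).-1
        = \sum_(j | j != i) (gap (cliquev i b |: F) j).-1.
  by apply: eq_bigr => j ji; rewrite (gap_cliqueU j bF) (negbTE ji) addn0.
rewrite (gap_cliqueU i bF) eqxx.
by move: (\sum_(j | _) _) (gap _ _) => s g; lia.
Qed.

Lemma has_full_cliqueU F i b : cliquev i b \notin F ->
  has_full_clique (cliquev i b |: F) = has_full_clique F || (gap F i == 1).
Proof.
move=> bF; apply/existsP/orP => [[j]|[/existsP[j]|]].
- case: (eqVneq j i) => [->|ji] g0.
    by right; rewrite (gap_cliqueU i bF) (eqP g0) eqxx.
  left; apply/existsP; exists j.
  by rewrite (gap_cliqueU j bF) (negbTE ji) addn0.
- by rewrite (gap_cliqueU j bF) addn_eq0 => /andP[g0 _]; exists j.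
- by rewrite (gap_cliqueU i bF) eqxx => g1; exists i; lia.
Qed.

Lemma centreU_stats F c :
  [/\ clique_gap (centre c |: F) = clique_gap F,
      clique_excess (centre c |: F) = clique_excess F
    & has_full_clique (centre c |: F) = has_full_clique F].
Proof.
split; first by apply: eq_bigr => i _; rewrite gap_centreU.
  by apply: eq_bigr => i _; rewrite gap_centreU.
by apply: eq_existsb => i; rewrite gap_centreU.
Qed.

(** Once all centres are filled, the two sides are the costs of the two
    strategies, so the second one is then never strictly cheaper. *)
Lemma clique_excess_le F :
  clique_excess F <= clique_gap F - (0 < clique_gap F).
Proof.
have le P : \sum_(i | P i) (gap F i).-1 <= \sum_(i | P i) gap F i.
  by apply: leq_sum => i _; apply: leq_pred.
have [gap_gt0|_] := ltnP 0 (clique_gap F); last by rewrite subn0; apply: le.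
move: gap_gt0; rewrite lt0n sum_nat_eq0 => /forallPn[i gi].
rewrite /clique_excess /clique_gap (bigD1 i) //= [X in X - _](bigD1 i) //=.
move: (le (fun j => j != i)) gi => /=.
by move: (\sum_(j | _) _) (\sum_(j | _) _) (gap _ _) => s1 s2 g; lia.
Qed.

(** A token lowers a main term or switches on a correction, but not both in the
    same cost: the last vertex of a clique may yield the first full clique, but
    leaves the excess as it is, and the first filled centre leaves the clique
    gap as it is. *)
Lemma potential_token q F v : potential q F <= (potential q (v |: F)).+1.
Proof.
case vF: (v \in F); first by rewrite (setUidPr _) ?sub1set.
move/negbT: vF; case: v => [[i b]|c] vF.
  have := clique_gap_cliqueU vF; have := clique_excess_cliqueU vF.
  have := has_full_cliqueU vF; have := centre_gap_cliqueU F i b.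
  rewrite /potential /centre_cost /clique_cost /cliquev => -> -> -> ->.
  move: (gap F i) (clique_excess _) (clique_gap _) (centre_gap F) => g e s c.
  by case: (q == 0) has_full_clique => -[]; lia.
have := centreU_stats F c; have := centre_gap_centreU vF.
rewrite /potential /centre_cost /clique_cost /centre => -> [-> -> ->].
move: (clique_excess _) (clique_gap _) (centre_gap _) => e s c'.
by case: (q == 0) has_full_clique => -[]; lia.
Qed.

(** * Forces do not lower the potential *)

(** The conditions on W under which forcing in G[W] is as restricted as
    forcing in G: W contains every unfilled centre and is a union of components
    of the unfilled graph, up to filled vertices.  Being phrased through
    unfilled vertices only, they persist as F grows ([transparentU]), hence
    along a whole sequence of forces. *)
Definition transparent W F :=
  (forall x y : G, x \in W -> x \notin F -> y \notin F -> sedge x y -> y \in W)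
  /\ (forall c, centre c \notin F -> centre c \in W).

Lemma transparentU W F w : transparent W F -> transparent W (w |: F).
Proof.
case=> cl ce; split=> [x y xW|c]; rewrite !inE !negb_or.
  by case/andP=> _ xF /andP[_ yF]; apply: cl.
by case/andP=> _; apply: ce.
Qed.

Lemma gap1 F i b : cliquev i b \notin F ->
  (forall a, cliquev i a \notin F -> a = b) -> gap F i = 1.
Proof.
move=> bF U; rewrite /gap; apply/eqP/cards1P; exists b.
by apply/setP=> a; rewrite !inE; apply/idP/eqP => [/U|->].
Qed.

Lemma gap0 F i : (forall a, cliquev i a \in F) -> gap F i = 0.
Proof.
move=> full; apply/eqP; rewrite cards_eq0; apply/eqP/setP=> a.
by rewrite !inE full.
Qed.

(** If a centre is forced, then by a clique vertex; it is the last unfilled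
    centre and the forcing clique is full, so the correction for a full clique
    pays for it.  The cost of filling the cliques is unaffected, since [1 < l]
    provides another centre, which is filled already.

    If a clique vertex is forced, it is the last unfilled one of its clique, so
    the excess is unaffected.  Then either all centres are filled, and the cost
    of filling the cliques is not the smaller one; or the forcing vertex is a
    centre and the forced one is the last of all unfilled clique vertices, hence
    accounted for as free in that cost, while [1 < eta] provides another clique,
    already full. *)
Lemma potential_force q W F v w : transparent W F -> forces W F v w ->
  potential q F <= potential q (w |: F).
Proof.
move=> [cl ce] /forcesP[vF wW wF vw U].
case: w => [[i b]|c] in wW wF vw U *; last first.
  (* A centre [c] is forced. *)
  have c1 : centre_gap F = 1.
    apply/eqP/cards1P; exists c; apply/setP=> d; rewrite !inE.
    apply/idP/eqP => [dF|-> //].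
    have := U (centre d) (ce d dF) dF; case: v {U} vF vw => [[]|] //= _ _ _ _.
    by move/(_ isT) => [].
  have full : has_full_clique F.
    case: v vF vw U => [[i a]|] //= aF _ U; apply/existsP; exists i.
    apply/eqP/gap0 => b; apply/negPn/negP => bF.
    have ab : a != b by apply: contraNneq bF => <-.
    have := U (cliquev i b) (cl _ _ wW wF bF isT) bF.
    by rewrite /= eqxx ab => /(_ isT).
  have := centreU_stats F c; have := centre_gap_centreU wF.
  rewrite /potential /centre_cost /clique_cost /centre full c1.
  move=> [<-] [-> -> ->].
by move: (clique_excess _) (clique_gap _) => e s; case: (q == 0); lia.
(* All unfilled vertices of clique i are adjacent to the forced one. *)
have Wi a : cliquev i a \notin F -> cliquev i a \in W.
  move=> aF; case: (eqVneq b a) => [<- //|ba].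
  by apply: cl wW wF aF _; rewrite /= eqxx.
have gi : gap F i = 1.
  apply: (gap1 wF) => a aF; have := U _ (Wi a aF) aF.
  suff va : sedge v (cliquev i a) by move/(_ va) => [].
  case: v vF vw {U} => [[j d]|] //= dF /andP[/eqP ji _]; rewrite -ji eqxx /=.
  by apply: contraNneq aF => <-; rewrite -ji.
have := clique_gap_cliqueU wF; have := clique_excess_cliqueU wF.
have := has_full_cliqueU wF; have := centre_gap_cliqueU F i b.
have := clique_excess_le (cliquev i b |: F).
rewrite gi ltnn addn0 eqxx orbT.
case: (posnP (centre_gap F)) => [c0|c_gt0].
  rewrite /potential /centre_cost /clique_cost /cliquev => + -> _ -> ->.
  rewrite c0; move: (clique_excess _) (clique_gap _) => e s.
  by case: (q == 0); lia.
have [d dF] : exists d, centre d \notin F.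
  by case/card_gt0P: c_gt0 => d; rewrite inE; exists d.
(* An unfilled centre d is left, so the forcing vertex e is a centre. *)
case: v vF vw U => [[j a]|e] eF vw U.
  by have := U (centre d) (ce d dF) dF isT.
(* Through d every unfilled clique vertex lies in W, where e sees it. *)
have gj j : j != i -> gap F j = 0.
  move=> ji; apply: gap0 => a; apply/negPn/negP => aF.
  have := U _ (cl (centre d) _ (ce d dF) dF aF isT) aF isT.
  by case=> /eqP; rewrite (negbTE ji).
have U1 : clique_gap F = 1.
  by rewrite /clique_gap (bigD1 i) //= gi big1.
have full : has_full_clique F.
  have [j ji] : exists j, j != i.
    case: (eqVneq i (Ordinal (ltnW heta))) => [->|n0].
      by exists (Ordinal heta).
    by exists (Ordinal (ltnW heta)); rewrite eq_sym.
  by apply/existsP; exists j; rewrite gj.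
have cl_lt : centre_gap F < l.
  rewrite -[l]card_ord -cardsT; apply: proper_card.
  by apply/properP; split; [exact: subsetT | exists e; rewrite !inE // eF].
rewrite /potential /centre_cost /clique_cost /cliquev => + -> -> <- _.
rewrite full U1 cl_lt; move: (clique_excess _) (clique_gap _) => t s.
by case: (q == 0); lia.
Qed.

Lemma potential_forces q W F F' : transparent W F ->
  connect (force_step W) F F' -> potential q F <= potential q F'.
Proof.
move=> tr /connectP[p]; elim: p F tr => [|F1 p IHp] F tr /=.
  by move=> _ ->.
case/andP=> /existsP[v /existsP[w /andP[Fvw /eqP->]]] pth lst.
apply: leq_trans (potential_force q tr Fvw) (IHp _ _ pth lst).
exact: transparentU.
Qed.

(** * The oracle reveals the whole selection *)

(** A forcing vertex would have to be a clique vertex, which sees all revealed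
    centres; a unique one among them would mean that one component was
    selected. *)
Lemma no_force_full_cliques F S v w :
  (forall i a, cliquev i a \in F) -> S \subset components (~: F) ->
  1 < #|S| -> ~~ forces (F :|: cover S) F v w.
Proof.
move=> full sS S2; apply/negP=> /forcesP[vF wW wF vw U].
suff : S \subset [set [set w]].
  by move/subset_leq_card; rewrite cards1 leqNgt S2.
apply/subsetP=> B BS; rewrite inE.
suff sB : B \subset [set w].
  by move: sB (component_neq0 (subsetP sS B BS)); rewrite subset1 => /orP[|->].
apply/subsetP=> x xB; rewrite inE; apply/eqP.
have xS : x \in cover S by apply/bigcupP; exists B.
have := subsetP (cover_components_sub sS) x xS; rewrite inE => xF.
apply: U => //; first by rewrite inE xS orbT.
case: x xF {xB xS} => [[i a]|c] xF.
  by rewrite [inl _]/(cliquev i a) full in xF.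
case: w vw wF {wW} => [[i a]|d] vw wF.
  by rewrite [inl _]/(cliquev i a) full in wF.
by case: v vF vw => [[]|].
Qed.

(** Unless all cliques are full, F together with the selection is [transparent]
    relative to F: an unfilled clique vertex joins all unfilled centres into the
    component of any selected vertex. *)
Lemma potential_oracle q F S F' :
  S \subset components (~: F) -> q < #|S| ->
  connect (force_step (F :|: cover S)) F F' ->
  potential q F <= potential q F'.
Proof.
move=> sS qS FF'.
have closedW x y : x \in F :|: cover S -> x \notin F -> y \notin F ->
    sedge x y -> y \in F :|: cover S.
  rewrite !inE => /orP[->//|xS] _ yF xy; apply/orP; right.
  by apply: cover_components_closed sS xS _ xy; rewrite inE.
case: (altP (@forallP _ (fun p : 'I_eta * 'I_k => cliquev p.1 p.2 \in F)))
  => [full|].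
  case: (posnP q) => [->|q_gt0].
    rewrite /potential /clique_cost /clique_gap eqxx big1 ?minn0 // => i _.
    by apply: gap0 => a; apply: (full (i, a)).
  case/connectP: FF' => -[|F1 p] /=; first by move=> _ ->.
  case/andP=> /existsP[v /existsP[w /andP[+ _]]] _ _; apply: contraLR => _.
  apply: no_force_full_cliques => // [i a|]; first exact: (full (i, a)).
  exact: leq_trans qS.
case/forallPn=> -[i a] /= aF.
apply: potential_forces FF'; split=> // c cF.
(* From any selected vertex x, the centre c is reached directly if x is a clique
   vertex, and through [cliquev i a] if x is a centre. *)
have /set0Pn[B BS] : S != set0 by rewrite -card_gt0 (leq_ltn_trans _ qS).
have /set0Pn[x xB] := component_neq0 (subsetP sS B BS).
have xS : x \in cover S by apply/bigcupP; exists B.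
have := subsetP (cover_components_sub sS) x xS; rewrite inE => xF.
have xW : x \in F :|: cover S by rewrite inE xS orbT.
case: x xB xS xF xW => [[j b]|d] _ _ xF xW; first exact: closedW xW xF cF isT.
exact: closedW (closedW _ _ xW xF aF isT) aF cF isT.
Qed.

Lemma potential_setT q : potential q [set: G] = 0.
Proof.
have g0 i : gap [set: G] i = 0 by apply: gap0 => a; rewrite inE.
have c0 : centre_gap [set: G] = 0.
  by apply/eqP; rewrite cards_eq0; apply/eqP/setP=> c; rewrite !inE.
rewrite /potential /centre_cost /clique_cost c0 /clique_gap /clique_excess.
by rewrite !big1 ?minn0 ?if_same // => i _; rewrite g0.
Qed.

Lemma potential_set0 q : potential q (set0 : {set G}) =
  if q == 0 then minn (eta * (k - 1) + l) (eta * k) else eta * (k - 1) + l.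
Proof.
have gE i : gap (set0 : {set G}) i = k.
  by rewrite -[RHS]card_ord -cardsT; apply: eq_card => a; rewrite !inE.
have cE : centre_gap (set0 : {set G}) = l.
  by rewrite -[RHS]card_ord -cardsT; apply: eq_card => a; rewrite !inE.
have nf : has_full_clique (set0 : {set G}) = false.
  by apply/existsP=> -[i]; rewrite gE; lia.
rewrite /potential /centre_cost /clique_cost cE nf andbF ltnn !subn0.
rewrite /clique_gap /clique_excess (eq_bigr _ (fun i _ => gE i)).
rewrite (eq_bigr (fun=> k.-1)) => [|i _]; last by rewrite gE.
by rewrite !sum_nat_const card_ord subn1.
Qed.

Lemma wins_potential q F t : wins q F t -> potential q F <= t.
Proof.
apply: wins_lower_bound F t; first exact: potential_setT.
- exact: potential_token.
- by move=> F v w; apply: potential_force; split=> [x y|c] *; rewrite inE.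
- exact: potential_oracle.
Qed.

(** * The two strategies *)

(** Of each clique only the vertex [a0] is left unpaid; the vertex [a1], which
    exists as [1 < k], forces it. *)
Lemma wins_centre_strategy q :
  wins q (set0 : {set G}) (eta * (k - 1) + l).
Proof.
pose a0 : 'I_k := Ordinal (ltnW hk); pose a1 : 'I_k := Ordinal hk.
pose X : {set G} := [set x | if x is inl (i, a) then a != a0 else true].
have cX : #|X| = eta * (k - 1) + l.
  have -> : X = ~: [set cliquev i a0 | i : 'I_eta].
    apply/setP=> -[[i a]|c]; rewrite !inE; last first.
      by symmetry; apply/imsetP => -[].
    congr (~~ _); apply/eqP/imsetP => [->|[j _ []] //]; by exists i.
  rewrite cardsCs setCK card_imset => [|i j []] //.
  by rewrite card_sum card_prod !card_ord; nia.
rewrite -[_ + l]addn0 -cX; apply: wins_tokens; rewrite setU0.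
apply: wins_free => F sXF; rewrite -subTset => /subsetPn[w _ wF].
exists w => //.
have outF u : u \notin F -> exists i, u = cliquev i a0.
  move/(contra (subsetP sXF u)); case: u => [[i a]|c]; rewrite inE //.
  by rewrite negbK => /eqP->; exists i.
have [i Ew] := outF w wF; rewrite Ew in wF *.
apply: (@wins_force _ _ _ _ (cliquev i a1)); apply/forcesP; split=> //.
- by apply: (subsetP sXF); rewrite inE.
- by rewrite /= eqxx.
by move=> u _ /outF[j ->] /= /andP[/eqP->].
Qed.

(** The unfilled centres are pairwise nonadjacent, so each is isolated among the
    unfilled vertices, and any clique vertex can force it. *)
Lemma wins_clique_strategy : wins 0 (set0 : {set G}) (eta * k).
Proof.
pose X : {set G} := [set inl p | p : 'I_eta * 'I_k].
have cX : #|X| = eta * k.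
  by rewrite card_imset => [|p r []] //; rewrite card_prod !card_ord.
rewrite -[_ * k]addn0 -cX; apply: wins_tokens; rewrite setU0.
apply: wins_free => F sXF; rewrite -subTset => /subsetPn[w _ wF].
exists w => //.
have cliqueF p : (inl p : G) \in F by apply: (subsetP sXF); apply: imset_f.
case: w wF => [p|c] wF; first by rewrite cliqueF in wF.
pose v := cliquev (Ordinal (ltnW heta)) (Ordinal (ltnW hk)).
apply: (@wins_isolated _ _ v) => //; first exact: cliqueF.
by case=> [p|//]; rewrite cliqueF.
Qed.

End Windmill.

Theorem theorem4p4 (k eta l : nat) (hk : 1 < k) (heta : 1 < eta) (hl : 1 < l)
    (q : nat) :
  Zq (windmill2 eta k l) q =
    if q == 0 then minn (eta * (k - 1) + l) (eta * k)
    else eta * (k - 1) + l.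
Proof.
apply: Zq_eq => [|t /(wins_potential hk heta hl)]; last first.
  by rewrite potential_set0.
case: eqP => [->|_]; last exact: wins_centre_strategy.
rewrite /minn; case: ifP => _; first exact: wins_centre_strategy.
exact: wins_clique_strategy.
Qed.
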